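(* Let $\mathbb{H}$ be a (normalized) quantum channel entropy. Then for all systems $A,B$ and every $\mathcal{N}\in\mathrm{CPTP}(A\to B)$, $\mathbb{H}(B|A)_{\mathcal{N}}\ge H_{\min}(B|A)_{\mathcal{N}}$, where $H_{\min}(B|A)_{\mathcal{N}}:=\log|B|-\log\min\{t\ge0:\ t\mathcal{R}^{A\to B}-\mathcal{N}\text{ is completely positive}\}$ and $\mathcal{R}^{A\to B}(\rho)=\mathrm{Tr}[\rho]\mathbf{u}^B$.
   Context: Systems are finite-dimensional; $\mathbf{u}^B=I^B/|B|$; $\log$ base 2; states are identified with channels with trivial input. A superchannel from $\mathrm{CPTP}(A\to B)$ to $\mathrm{CPTP}(A'\to B)$ is $\Theta[\mathcal{N}]=\mathcal{E}^{RB\to B}\circ\mathcal{N}^{A\to B}\circ\mathcal{V}^{A'\to RA}$ with $\mathcal{V}$ an isometry channel and $\mathcal{E}$ a channel; it is mixing if in a realization with minimal $|R|$, $\mathcal{E}(\tau^R\otimes\mathbf{u}^B)=\mathbf{u}^B$ for every density matrix $\tau^R$. For same output, $\mathcal{N}\succ\mathcal{M}$ iff $\mathcal{M}=\Theta[\mathcal{N}]$ for a mixing $\Theta$; for $\mathcal{N}\in\mathrm{CPTP}(A\to B)$, $\mathcal{M}\in\mathrm{CPTP}(A'\to B')$: if $|B|>|B'|$, $\mathcal{N}\succ\mathcal{M}$ iff $\mathcal{N}\succ\mathcal{U}\circ\mathcal{M}$ for some isometry channel $\mathcal{U}:B'\to B$; if $|B|\le|B'|$, iff $\mathcal{W}\circ\mathcal{N}\succ\mathcal{M}$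 for some isometry channel $\mathcal{W}:B\to B'$. A (normalized) channel entropy is a function $\mathcal{N}^{A\to B}\mapsto\mathbb{H}(B|A)_{\mathcal{N}}\in\mathbb{R}$ on all channels between finite-dimensional systems, not identically zero, such that: (monotonicity) $\mathcal{N}^{A\to B}\succ\mathcal{M}^{A'\to B'}$ implies $\mathbb{H}(B|A)_{\mathcal{N}}\le\mathbb{H}(B'|A')_{\mathcal{M}}$; (additivity) $\mathbb{H}(BB'|AA')_{\mathcal{N}\otimes\mathcal{M}}=\mathbb{H}(B|A)_{\mathcal{N}}+\mathbb{H}(B'|A')_{\mathcal{M}}$; (normalization) the uniform qubit state has entropy $1$. *)

(* Defs.v *)
From mathcomp Require Import all_boot all_order all_algebra.
From mathcomp Require Import complex mxtens.
From mathcomp Require Import all_classical all_reals exp.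

Unset Implicit Arguments.
Unset Strict Implicit.
Unset Printing Implicit Defensive.

Import Order.TTheory GRing.Theory Num.Theory.
Local Open Scope ring_scope.
Local Open Scope sesquilinear_scope.

Section QuantumChannels.
Variable R : realType.
Local Notation C := R[i].

Definition rC (x : R) : C := real_complex R x.

(* A system of dimension n has operator space 'M[C]_n.
   Positive semidefinite: v^* A v is a nonnegative real for every v
   (in C = R[i], 0 <= z means Im z = 0 and Re z >= 0). *)
Definition psd {n : nat} (A : 'M[C]_n) : Prop :=
  forall v : 'cV[C]_n, 0 <= (v ^t* *m A *m v) 0 0.

(* Block (i,j) of an operator on a bipartite system K (x) N, where the
   tensor index convention is the one of mxtens (i, r) |-> i * n + r. *)
Definition blk {k n : nat} (X : 'M[C]_(k * n)) (i j : 'I_k) : 'M[C]_n :=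
  \matrix_(r, s) X (mxtens_index (i, r)) (mxtens_index (j, s)).

(* Tensor product f (x) g of two linear maps, defined through the block
   decomposition X = \sum_{i,j} E_ij (x) X_ij. *)
Definition tensmap {a a' b b' : nat}
  (f : 'M[C]_a -> 'M[C]_b) (g : 'M[C]_a' -> 'M[C]_b')
  (X : 'M[C]_(a * a')) : 'M[C]_(b * b') :=
  \sum_(i < a) \sum_(j < a) (f (delta_mx i j) *t g (blk X i j)).

Definition ampl (k : nat) {a b : nat} (f : 'M[C]_a -> 'M[C]_b) :
  'M[C]_(k * a) -> 'M[C]_(k * b) := tensmap (@id 'M[C]_k) f.

Definition linmap {a b : nat} (f : 'M[C]_a -> 'M[C]_b) : Prop :=
  forall (c : C) (X Y : 'M[C]_a), f (c *: X + Y) = c *: f X + f Y.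

Definition CP {a b : nat} (f : 'M[C]_a -> 'M[C]_b) : Prop :=
  forall (k : nat) (X : 'M[C]_(k * a)), psd X -> psd (ampl k f X).

Definition TP {a b : nat} (f : 'M[C]_a -> 'M[C]_b) : Prop :=
  forall X : 'M[C]_a, \tr (f X) = \tr X.

Definition is_channel {a b : nat} (f : 'M[C]_a -> 'M[C]_b) : Prop :=
  [/\ linmap f, CP f & TP f].

Definition umx (n : nat) : 'M[C]_n := (n%:R)^-1 *: 1%:M.

Definition density {n : nat} (t : 'M[C]_n) : Prop := psd t /\ \tr t = 1.

Definition isometry {m n : nat} (W : 'M[C]_(m, n)) : Prop :=
  W ^t* *m W = 1%:M.
Definition isoch {m n : nat} (W : 'M[C]_(m, n)) (X : 'M[C]_n) : 'M[C]_m :=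
  W *m X *m W ^t*.

Definition superfun {a a' b r : nat} (W : 'M[C]_(r * a, a'))
  (E : 'M[C]_(r * b) -> 'M[C]_b) (N : 'M[C]_a -> 'M[C]_b) :
  'M[C]_a' -> 'M[C]_b := fun X => E (ampl r N (isoch W X)).

Definition realization {a a' b : nat}
  (Th : ('M[C]_a -> 'M[C]_b) -> ('M[C]_a' -> 'M[C]_b))
  (r : nat) (W : 'M[C]_(r * a, a')) (E : 'M[C]_(r * b) -> 'M[C]_b) : Prop :=
  [/\ (0 < r)%N, isometry W, is_channel E &
      forall N : 'M[C]_a -> 'M[C]_b, is_channel N -> Th N =1 superfun W E N].

Definition mixing {a a' b : nat}
  (Th : ('M[C]_a -> 'M[C]_b) -> ('M[C]_a' -> 'M[C]_b)) : Prop :=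
  exists (r : nat) (W : 'M[C]_(r * a, a')) (E : 'M[C]_(r * b) -> 'M[C]_b),
    [/\ realization Th r W E,
        (forall (r' : nat) (W' : 'M[C]_(r' * a, a'))
                (E' : 'M[C]_(r' * b) -> 'M[C]_b),
           realization Th r' W' E' -> (r <= r')%N) &
        forall tau : 'M[C]_r, density tau -> E (tau *t umx b) = umx b].

Definition maj_same {a a' b : nat}
  (N : 'M[C]_a -> 'M[C]_b) (M : 'M[C]_a' -> 'M[C]_b) : Prop :=
  exists Th : ('M[C]_a -> 'M[C]_b) -> ('M[C]_a' -> 'M[C]_b),
    mixing Th /\ M =1 Th N.

Definition maj {a b a' b' : nat}
  (N : 'M[C]_a -> 'M[C]_b) (M : 'M[C]_a' -> 'M[C]_b') : Prop :=
  if (b' < b)%N then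
    exists U : 'M[C]_(b, b'), isometry U /\ maj_same N (isoch U \o M)
  else
    exists W : 'M[C]_(b', b), isometry W /\ maj_same (isoch W \o N) M.

(* A (normalized) channel entropy: a real function on channels between
   finite-dimensional (positive-dimensional) systems.  It is given as a
   function on all maps; only its values on channels are constrained. *)
Definition channel_entropy
  (H : forall a b : nat, ('M[C]_a -> 'M[C]_b) -> R) : Prop :=
  [/\ (exists (a b : nat) (N : 'M[C]_a -> 'M[C]_b),
         [/\ (0 < a)%N, (0 < b)%N, is_channel N & H a b N <> 0]),
      (forall (a b a' b' : nat) (N : 'M[C]_a -> 'M[C]_b)
              (M : 'M[C]_a' -> 'M[C]_b'),
         (0 < a)%N -> (0 < b)%N -> (0 < a')%N -> (0 < b')%N ->
         is_channel N -> is_channel M -> maj N M -> H a b N <= H a' b' M),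
      (forall (a b a' b' : nat) (N : 'M[C]_a -> 'M[C]_b)
              (M : 'M[C]_a' -> 'M[C]_b'),
         (0 < a)%N -> (0 < b)%N -> (0 < a')%N -> (0 < b')%N ->
         is_channel N -> is_channel M ->
         H (a * a')%N (b * b')%N (tensmap N M) = H a b N + H a' b' M) &
      (* the uniform qubit state, as a channel with trivial input *)
      H 1%N 2%N (fun X : 'M[C]_1 => \tr X *: umx 2) = 1].

Definition Rmap (a b : nat) (X : 'M[C]_a) : 'M[C]_b := \tr X *: umx b.

Definition log2 (x : R) : R := ln x / ln 2.

Definition Hmin {a b : nat} (N : 'M[C]_a -> 'M[C]_b) : R :=
  log2 (b%:R) -
  log2 (inf [set t : R | 0 <= t /\ CP (fun X => rC t *: Rmap a b X - N X)]).

End QuantumChannels.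

(* Main.v *)
(* Let [t R - N] be completely positive, with [u_m] the uniform state on an
   m-dimensional system and [b] the output dimension of [N].  Whenever
   [k t < b m], the flat state of rank [k] on the output of [N (x) u_m]
   majorizes [N (x) u_m]: apply [N (x) u_m] if the state is found in its
   k-dimensional support, and otherwise the channel that makes the average
   completely randomizing.  Monotonicity and additivity turn this into
   [log k <= H N + log m], and [k / m] may approach [b / t].  The detour
   through [u_m] is what allows [H N] to be negative.  The values
   [H u_n = log n] come from the same majorization between flat states. *)
Require Import Defs.
From mathcomp Require Import all_boot all_order all_algebra.
From mathcomp Require Import complex mxtens.
From mathcomp Require Import all_classical all_reals sequences exp.
From mathcomp Require Import ring lra.
Import Order.TTheory GRing.Theory Num.Theory.
Local Open Scope ring_scope.
Local Open Scope sesquilinear_scope.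

(** * Complete positivity in terms of operator blocks *)

Section CompletePositivity.
Context {R : realType}.
Local Notation C := R[i].

Lemma adjmxM {m n p} (A : 'M[C]_(m, n)) (B : 'M[C]_(n, p)) :
  (A *m B) ^t* = B ^t* *m A ^t*.
Proof. by rewrite trmx_mul map_mxM. Qed.

Lemma big_mxtens {V : nmodType} {m n} (F : 'I_(m * n) -> V) :
  \sum_i F i = \sum_(i < m) \sum_(s < n) F (mxtens_index (i, s)).
Proof.
rewrite pair_big /= (reindex (@mxtens_index m n)) /=.
  by apply: eq_bigr => -[i s] _.
by exists (@mxtens_unindex m n) => i _; rewrite ?mxtens_indexK ?mxtens_unindexK.
Qed.

(** Positivity of a bipartite operator given by its blocks, free of the [mxtens] indices. Since
    [ampl] acts block by block, composition, sums and conjugations of completely positive maps need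
    no tensor calculus. *)
Definition block_psd {k n} (Y : 'I_k -> 'I_k -> 'M[C]_n) : Prop :=
  forall v : 'I_k -> 'cV[C]_n,
    0 <= \sum_i \sum_j ((v i) ^t* *m Y i j *m v j) 0 0.

Lemma psd_blockP {k n} (X : 'M[C]_(k * n)) : psd R X <-> block_psd (blk R X).
Proof.
have quadE (v : 'cV[C]_(k * n)) (w : 'I_k -> 'cV[C]_n) :
    (forall i r, v (mxtens_index (i, r)) 0 = w i r 0) ->
    (v ^t* *m X *m v) 0 0 =
    \sum_i \sum_j ((w i) ^t* *m blk R X i j *m w j) 0 0.
  move=> vw; rewrite mxE big_mxtens.
  under eq_bigr do under eq_bigr do rewrite mxE big_mxtens mulr_suml.
  under [RHS]eq_bigr do under eq_bigr do rewrite mxE.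
  rewrite [RHS]exchange_big /=; apply: eq_bigr => j _.
  rewrite [RHS]exchange_big /=; apply: eq_bigr => s _.
  apply: eq_bigr => i _; rewrite mxE !mulr_suml; apply: eq_bigr => r _.
  by rewrite !mxE !vw.
split=> [pX w | pX v].
  rewrite -(quadE (\col_x w (mxtens_unindex x).1 (mxtens_unindex x).2 0)).
    exact: pX.
  by move=> i r; rewrite mxE mxtens_indexK.
rewrite (quadE v (fun i => \col_r v (mxtens_index (i, r)) 0)); first exact: pX.
by move=> i r; rewrite mxE.
Qed.

Lemma blk_ampl {k a b} (f : 'M[C]_a -> 'M[C]_b) (X : 'M[C]_(k * a)) i j :
  blk R (ampl R k f X) i j = f (blk R X i j).
Proof.
apply/matrixP => r s; rewrite mxE /ampl /tensmap.
rewrite summxE (bigD1 i) //= summxE (bigD1 j) //= tensmxE mxE !eqxx mul1r.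
rewrite big1 ?addr0 => [|j' /negPf j'j]; last first.
  by rewrite tensmxE mxE [j == _]eq_sym j'j andbF mul0r.
rewrite big1 ?addr0 // => i' /negPf i'i; rewrite summxE big1 // => j' _.
by rewrite tensmxE mxE [i == _]eq_sym i'i mul0r.
Qed.

Lemma CP_blockP {a b} (f : 'M[C]_a -> 'M[C]_b) :
  CP R f <-> forall k (Y : 'I_k -> 'I_k -> 'M[C]_a),
    block_psd Y -> block_psd (fun i j => f (Y i j)).
Proof.
split=> [cpf k Y pY | cpf k X /psd_blockP/cpf pX].
  pose X : 'M[C]_(k * a) := \matrix_(x, y)
    Y (mxtens_unindex x).1 (mxtens_unindex y).1
      (mxtens_unindex x).2 (mxtens_unindex y).2.
  have XE i j : blk R X i j = Y i j.
    by apply/matrixP => r s; rewrite !mxE !mxtens_indexK.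
  have /cpf/psd_blockP pfX : psd R X.
    by apply/psd_blockP => v; under eq_bigr do under eq_bigr do rewrite XE.
  move=> v; have := pfX v.
  by under eq_bigr do under eq_bigr do rewrite blk_ampl XE.
by apply/psd_blockP => v; under eq_bigr do under eq_bigr do rewrite blk_ampl.
Qed.

Lemma eq_CP {a b} {f g : 'M[C]_a -> 'M[C]_b} : f =1 g -> CP R f -> CP R g.
Proof. by move=> /funext->. Qed.

Lemma CP_comp {a b c} {g : 'M[C]_b -> 'M[C]_c} {f : 'M[C]_a -> 'M[C]_b} :
  CP R g -> CP R f -> CP R (fun X => g (f X)).
Proof.
by move=> /CP_blockP cpg /CP_blockP cpf; apply/CP_blockP => k Y /cpf/cpg.
Qed.

Lemma CP_add {a b} {f g : 'M[C]_a -> 'M[C]_b} :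
  CP R f -> CP R g -> CP R (fun X => f X + g X).
Proof.
move=> /CP_blockP cpf /CP_blockP cpg; apply/CP_blockP => k Y pY v.
under eq_bigr do under eq_bigr do rewrite mulmxDr mulmxDl mxE.
under eq_bigr do rewrite big_split.
by rewrite big_split addr_ge0 //; [apply: cpf | apply: cpg].
Qed.

Lemma CP_scale {a b} {c : C} {f : 'M[C]_a -> 'M[C]_b} :
  0 <= c -> CP R f -> CP R (fun X => c *: f X).
Proof.
move=> c0 /CP_blockP cpf; apply/CP_blockP => k Y pY v.
under eq_bigr do under eq_bigr do rewrite -scalemxAr -scalemxAl mxE.
under eq_bigr do rewrite -mulr_sumr.
by rewrite -mulr_sumr mulr_ge0 //; apply: cpf.
Qed.

Lemma CP_sum {a b} {I : Type} {r : seq I} {P : pred I}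
  {f : I -> 'M[C]_a -> 'M[C]_b} :
  (forall i, P i -> CP R (f i)) -> CP R (fun X => \sum_(i <- r | P i) f i X).
Proof.
move=> cpf; elim: r => [|i r IHr].
  apply/CP_blockP => k Y _ v; rewrite big1 // => i _; rewrite big1 // => j _.
  by rewrite big_nil mulmx0 mul0mx mxE.
have [Pi | nPi] := boolP (P i).
  by apply: (eq_CP _ (CP_add (cpf _ Pi) IHr)) => X; rewrite big_cons Pi.
by apply: (eq_CP _ IHr) => X; rewrite big_cons (negPf nPi).
Qed.

(** The Kraus operator moves onto the test vectors, which become [K ^t* *m v i]. *)
Lemma CP_conj {a b} (K : 'M[C]_(b, a)) : CP R (fun X => K *m X *m K ^t*).
Proof.
apply/CP_blockP => k Y pY v.
have := pY (fun i => K ^t* *m v i); congr (0 <= _).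
apply: eq_bigr => i _; apply: eq_bigr => j _.
by rewrite adjmxM trmxCK !mulmxA.
Qed.

Lemma linmap0 {a b} {f : 'M[C]_a -> 'M[C]_b} : linmap R f -> f 0 = 0.
Proof. by move=> /(_ (-1) 0 0); rewrite scaler0 addr0 scaleN1r addNr. Qed.

Lemma linmapZ {a b} {f : 'M[C]_a -> 'M[C]_b} (c : C) X :
  linmap R f -> f (c *: X) = c *: f X.
Proof. by move=> linf; rewrite -[c *: X]addr0 linf linmap0 // addr0. Qed.

Lemma linmap_sum {a b} {f : 'M[C]_a -> 'M[C]_b} {I : Type} (r : seq I)
  (c : I -> C) (Z : I -> 'M[C]_a) : linmap R f ->
  f (\sum_(i <- r) c i *: Z i) = \sum_(i <- r) c i *: f (Z i).
Proof.
move=> linf; elim: r => [|i r IHr]; last by rewrite !big_cons linf IHr.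
by rewrite !big_nil linmap0.
Qed.

(** A one-dimensional ancilla suffices: testing [f 1%:M] on the basis vectors shows that each
    diagonal entry is nonnegative. *)
Lemma CP_trace_ge0 {a b} {f : 'M[C]_a -> 'M[C]_b} :
  CP R f -> 0 <= \tr (f 1%:M).
Proof.
move=> /CP_blockP/(_ 1%N (fun _ _ => 1%:M)) cpf.
have /cpf pf : block_psd (fun _ _ : 'I_1 => 1%:M : 'M[C]_a).
  move=> v; rewrite !big_ord1 mulmx1 mxE sumr_ge0 // => i _.
  by rewrite !mxE mulrC mul_conjC_ge0.
apply: sumr_ge0 => r _; have := pf (fun=> delta_mx r 0); rewrite !big_ord1.
rewrite trmx_delta map_delta_mx -rowE -colE !mxE.
by [].
Qed.

(** * Kraus forms and domination by the completely randomizing map *)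

Lemma delta_conjE {a} b r s (X : 'M[C]_a) :
  delta_mx r s *m X *m (delta_mx r s) ^t* = X s s *: (delta_mx r r : 'M[C]_b).
Proof.
apply/matrixP => i j; rewrite trmx_delta map_delta_mx.
rewrite mxE (bigD1 s) //= big1 => [|k /negPf ks]; last first.
  by rewrite [delta_mx s r _ _]mxE ks mulr0.
rewrite mxE (bigD1 s) //= big1 => [|k /negPf ks]; last first.
  by rewrite mxE ks andbF mul0r.
rewrite !mxE !eqxx !andbT !addr0.
by case: (i == r); case: (j == r); rewrite ?mul1r ?mul0r ?mulr0 ?mulr1.
Qed.

Lemma scalar_mx_sum_delta n : 1%:M = \sum_r delta_mx r r :> 'M[C]_n.
Proof.
rewrite [LHS]matrix_sum_delta; apply: eq_bigr => i _.
rewrite (bigD1 i) //= big1 => [|j /negPf ji].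
  by rewrite mxE eqxx scale1r addr0.
by rewrite mxE eq_sym ji scale0r.
Qed.

Lemma trace_mapE {a} b (X : 'M[C]_a) :
  \sum_(r < b) \sum_(s < a) delta_mx r s *m X *m (delta_mx r s) ^t* =
  \tr X *: 1%:M.
Proof.
rewrite scalar_mx_sum_delta scaler_sumr; apply: eq_bigr => r _.
by rewrite scaler_suml; apply: eq_bigr => s _; rewrite delta_conjE.
Qed.

Lemma CP_Rmap a b : CP R (Rmap R a b).
Proof.
have cp : CP R (fun X : 'M[C]_a => \tr X *: (1%:M : 'M[C]_b)).
  apply: (eq_CP (trace_mapE b)).
  by apply: CP_sum => r _; apply: CP_sum => s _; apply: CP_conj.
have c0 : (0 : C) <= (b%:R)^-1 by rewrite invr_ge0 ler0n.
by apply: (eq_CP _ (CP_scale c0 cp)) => X; rewrite /Rmap /umx !scalerA mulrC.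
Qed.

(* With P_s the diagonal matrix units,
   n \sum_s P_s X P_s - X = 1/2 \sum_(s, t) (P_s - P_t) X (P_s - P_t)  and
   (\tr X) 1 - \sum_s P_s X P_s = \sum_(r != s) E_rs X E_rs^*. *)
Lemma CP_trace_dominates n :
  CP R (fun X : 'M[C]_n => n%:R *: (\tr X *: 1%:M) - X).
Proof.
pose P s : 'M[C]_n := delta_mx s s.
pose f X := n%:R *: (\sum_(r < n) \sum_(s < n | s != r)
  delta_mx r s *m X *m (delta_mx r s) ^t*)
  + 2^-1 *: \sum_s \sum_t (P s - P t) *m X *m (P s - P t) ^t*.
apply: (eq_CP (f := f)); last first.
  apply: CP_add; apply: CP_scale; rewrite ?ler0n ?invr_ge0 ?ler0n //.
    by apply: CP_sum => r _; apply: CP_sum => s _; apply: CP_conj.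
  by apply: CP_sum => r _; apply: CP_sum => s _; apply: CP_conj.
move=> X; rewrite /f -trace_mapE.
have adjP s : (P s) ^t* = P s by rewrite trmx_delta map_delta_mx.
have sumP : \sum_s P s = 1%:M by rewrite scalar_mx_sum_delta.
have -> : \sum_s \sum_t (P s - P t) *m X *m (P s - P t) ^t* =
    2%:R *: (n%:R *: (\sum_s P s *m X *m P s) - X).
  transitivity (\sum_s \sum_t ((P s *m X *m P s + P t *m X *m P t)
      - (P s *m X *m P t + P t *m X *m P s))).
    apply: eq_bigr => s _; apply: eq_bigr => t _.
    rewrite linearB map_mxB !adjP !mulmxBl !mulmxBr opprB.
    by rewrite addrACA opprD.
  under eq_bigr do rewrite sumrB !big_split.
  rewrite sumrB !big_split /=.
  have X1 : \sum_s \sum_t P s *m X *m P t = X.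
    under eq_bigr do rewrite -mulmx_sumr sumP mulmx1.
    by rewrite -mulmx_suml sumP mul1mx.
  have X2 : \sum_s \sum_(t < n) P s *m X *m P s =
      n%:R *: \sum_s P s *m X *m P s.
    rewrite scaler_sumr; apply: eq_bigr => s _.
    by rewrite sumr_const card_ord scaler_nat.
  rewrite X1 X2 exchange_big /= X2 exchange_big /= X1.
  by rewrite !scaler_nat mulrnBl !mulr2n.
rewrite scalerA mulVf ?pnatr_eq0 // scale1r addrA -scalerDr; congr (_ *: _ - _).
rewrite -big_split; apply: eq_bigr => r _ /=.
by rewrite [RHS](bigD1 r) //= addrC; congr (_ + _); rewrite adjP.
Qed.

(** [CP_trace_dominates] after [N]: one factor [b] comes from that bound, the other from writing the
    identity as [b] times [umx b]. This makes the set in [Hmin] nonempty. *)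
Lemma CP_dominated_by_Rmap {a b} {N : 'M[C]_a -> 'M[C]_b} :
  (0 < b)%N -> is_channel R N ->
  CP R (fun X => rC R (b ^ 2)%:R *: Rmap R a b X - N X).
Proof.
move=> b0 [_ cpN tpN]; apply: (eq_CP _ (CP_comp (CP_trace_dominates b) cpN)).
move=> X /=; rewrite tpN /Rmap /umx /rC rmorph_nat !scalerA.
congr (_ *: _ - _); rewrite natrX; field.
by rewrite pnatr_eq0 -lt0n.
Qed.

End CompletePositivity.

(** * Slices of bipartite operators, tensoring with uniform states, and majorization by flat
    states *)

Section FlatStates.
Context {R : realType}.
Local Notation C := R[i].

Lemma sum_if_ltn {V : nmodType} {k b} (x y : V) : (k <= b)%N ->
  \sum_(s < b) (if (s < k)%N then x else y) = x *+ k + y *+ (b - k).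
Proof.
move=> kb; rewrite -(big_mkord xpredT (fun s => if (s < k)%N then x else y)).
rewrite (big_cat_nat (leq0n k) kb) /=; congr (_ + _).
  under eq_big_nat => i /andP[_ ik] do rewrite ik.
  by rewrite sumr_const_nat subn0.
under eq_big_nat => i /andP[ki _] do rewrite ltnNge ki.
by rewrite sumr_const_nat.
Qed.

(* The operator 1 (x) <s| on a bipartite system. *)
Definition slice {n m} (s : 'I_m) : 'M[C]_(n, n * m) :=
  \matrix_(i, x) (x == mxtens_index (i, s))%:R.

Lemma slice_mulE {n m p} (s : 'I_m) (Y : 'M[C]_(n * m, p)) i j :
  (slice s *m Y) i j = Y (mxtens_index (i, s)) j.
Proof.
rewrite mxE (bigD1 (mxtens_index (i, s))) //= big1 => [|x /negPf xi].
  by rewrite mxE eqxx mul1r addr0.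
by rewrite mxE xi mul0r.
Qed.

Lemma mul_adj_sliceE {n m p} (s : 'I_m) (Y : 'M[C]_(p, n * m)) i j :
  (Y *m (slice s) ^t*) i j = Y i (mxtens_index (j, s)).
Proof.
rewrite mxE (bigD1 (mxtens_index (j, s))) //= big1 => [|x /negPf xj].
  by rewrite !mxE eqxx conjC_nat mulr1 addr0.
by rewrite !mxE xj conjC_nat mulr0.
Qed.

Lemma slice_conjE {n m} (s : 'I_m) (Y : 'M[C]_(n * m)) i j :
  (slice s *m Y *m (slice s) ^t*) i j =
  Y (mxtens_index (i, s)) (mxtens_index (j, s)).
Proof. by rewrite mul_adj_sliceE slice_mulE. Qed.

Lemma slice_tens_indexE {n m} (s r : 'I_m) (i j : 'I_n) :
  slice s i (mxtens_index (j, r)) = ((j == i) && (r == s))%:R.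
Proof. by rewrite mxE (can_eq (@mxtens_indexK n m)). Qed.

(** The adjoint of a slice is 1 (x) |s>, and the projectors |s><s| sum to 1. This is a Kraus form of
    tensoring with the identity. *)
Lemma sum_slice_adj_conj {n} m (A : 'M[C]_n) :
  \sum_(s < m) (slice s) ^t* *m A *m slice s = A *t 1%:M.
Proof.
apply/matrixP => x y; case: (mxtens_indexP x) => i r.
case: (mxtens_indexP y) => j t; rewrite summxE tensmxE mxE.
have sliceE s : ((slice s) ^t* *m A *m slice s) (mxtens_index (i, r))
    (mxtens_index (j, t)) = (r == s)%:R * (A i j * (t == s)%:R).
  rewrite mxE (bigD1 j) //= big1 => [|k /negPf kj]; last first.
    by rewrite slice_tens_indexE eq_sym kj mulr0.
  rewrite slice_tens_indexE eqxx addr0 mulrA; congr (_ * _).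
  rewrite mxE (bigD1 i) //= big1 => [|k /negPf ki]; last first.
    by rewrite mxE [_^T _ _]mxE slice_tens_indexE eq_sym ki conjC_nat mul0r.
  by rewrite mxE [_^T _ _]mxE slice_tens_indexE eqxx conjC_nat addr0.
rewrite (bigD1 r) //= big1 => [|s /negPf sr].
  by rewrite sliceE eqxx mul1r addr0 eq_sym.
by rewrite sliceE [r == s]eq_sym sr mul0r.
Qed.

Lemma trace_slice0 {n} (X : 'M[C]_(n * 1)) :
  \tr (slice ord0 *m X *m (slice ord0) ^t*) = \tr X.
Proof.
rewrite /mxtrace big_mxtens; apply: eq_bigr => i _.
by rewrite big_ord1 slice_conjE.
Qed.

(** With a trivial second factor the slice is the unitary identifying [n * 1] with [n], two
    dimensions that are equal but not convertible. *)
Lemma isometry_slice_adj n : Defs.isometry R ((@slice n 1 ord0) ^t*).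
Proof.
apply/matrixP => i j; rewrite trmxCK slice_mulE !mxE.
by rewrite (can_eq (@mxtens_indexK n 1)) xpair_eqE eqxx andbT conjC_nat eq_sym.
Qed.

Lemma umx_tens m n : umx R m *t umx R n = umx R (m * n).
Proof.
apply/matrixP => x y; case: (mxtens_indexP x) => i r.
case: (mxtens_indexP y) => j t; rewrite tensmxE !mxE.
rewrite (can_eq (@mxtens_indexK m n)) xpair_eqE natrM invfM.
by case: (i == j); case: (r == t); rewrite ?mulr0 ?mul0r ?mulr1.
Qed.

Lemma trace_tens {m n} (A : 'M[C]_m) (B : 'M[C]_n) : \tr (A *t B) = \tr A * \tr B.
Proof.
rewrite /mxtrace big_mxtens mulr_suml; apply: eq_bigr => i _.
by rewrite mulr_sumr; apply: eq_bigr => r _; rewrite tensmxE.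
Qed.

Lemma trace_umx {n} : (0 < n)%N -> \tr (umx R n) = 1.
Proof.
by move=> n0; rewrite mxtraceZ mxtrace1 mulVf // pnatr_eq0 -lt0n.
Qed.

Lemma linmap_Rmap a b : linmap R (Rmap R a b).
Proof. by move=> c X Y; rewrite /Rmap mxtraceD mxtraceZ scalerDl scalerA. Qed.

Lemma is_channel_Rmap a {b} : (0 < b)%N -> is_channel R (Rmap R a b).
Proof.
move=> b0; split; first 1 last.
- exact: CP_Rmap.
- by move=> X; rewrite mxtraceZ trace_umx ?mulr1.
- exact: linmap_Rmap.
Qed.

(** The second factor is measured in the standard basis and the outcome [s] selects the channel
    applied to the first; the traces of the slices add up to the full trace. *)
Lemma is_channel_measure {a b m} {Phi : 'I_m -> 'M[C]_a -> 'M[C]_b} :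
  (forall s, is_channel R (Phi s)) ->
  is_channel R (fun Y => \sum_s Phi s (slice s *m Y *m (slice s) ^t*)).
Proof.
move=> chP; split=> [c X Y | | Y].
- rewrite /= scaler_sumr -big_split; apply: eq_bigr => s _ /=.
  have [linP _ _] := chP s.
  by rewrite -linP mulmxDr mulmxDl -scalemxAr -scalemxAl.
- apply: CP_sum => s _; have [_ cpP _] := chP s.
  exact: (CP_comp cpP (CP_conj _)).
- rewrite raddf_sum [RHS]/mxtrace big_mxtens [RHS]exchange_big /=.
  apply: eq_bigr => s _; have [_ _ tpP] := chP s.
  rewrite tpP; apply: eq_bigr => i _.
  by rewrite slice_conjE.
Qed.

Lemma CP_tens_umx {a b} m {f : 'M[C]_a -> 'M[C]_b} :
  CP R f -> CP R (fun X => f X *t umx R m).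
Proof.
move=> cpf.
have cp : CP R (fun X => (m%:R)^-1 *: \sum_(s < m)
    (slice s) ^t* *m f X *m ((slice s) ^t*) ^t*).
  apply: CP_scale; first by rewrite invr_ge0 ler0n.
  by apply: CP_sum => s _; apply: (CP_comp (CP_conj _) cpf).
apply: (eq_CP _ cp) => X; under eq_bigr do rewrite trmxCK.
rewrite sum_slice_adj_conj; apply/matrixP => x y.
by rewrite !mxE mulrCA.
Qed.

(** As the second input is trivial, the blocks of [X] are scalars, namely the entries of [X]
    transported to dimension [a]; linearity of [N] reassembles them. *)
Lemma tensmap_RmapE {a b m} {N : 'M[C]_a -> 'M[C]_b} : linmap R N ->
  tensmap R N (Rmap R 1 m) =1
  fun X => N (slice ord0 *m X *m (slice ord0) ^t*) *t umx R m.
Proof.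
move=> linN X; set Z := (_ *m X *m _).
have tE i j : Rmap R 1 m (blk R X i j) = Z i j *: umx R m.
  by rewrite /Rmap /mxtrace big_ord1 mxE slice_conjE.
have -> : N Z = \sum_i \sum_j Z i j *: N (delta_mx i j).
  rewrite {1}[Z]matrix_sum_delta pair_bigA linmap_sum //.
  by rewrite pair_bigA.
apply/matrixP => x y; rewrite summxE [RHS]mxE summxE mulr_suml.
apply: eq_bigr => i _; rewrite !summxE mulr_suml; apply: eq_bigr => j _.
by rewrite tE !mxE mulrCA mulrA.
Qed.

(** Stated as an equality of functions, since an entropy takes the function itself as argument;
    [1 * 1] computes to [1], so both sides have the same type. *)
Lemma tensmap_Rmap2 m n :
  tensmap R (Rmap R 1 m) (Rmap R 1 n) = Rmap R 1 (m * n).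
Proof.
apply/funext => X; rewrite tensmap_RmapE; last exact: linmap_Rmap.
rewrite /Rmap trace_slice0 -umx_tens.
by apply/matrixP => x y; rewrite !mxE !mulrA.
Qed.

Lemma is_channel_tens_Rmap {a b m} {N : 'M[C]_a -> 'M[C]_b} :
  (0 < m)%N -> is_channel R N -> is_channel R (tensmap R N (Rmap R 1 m)).
Proof.
move=> m0 [linN cpN tpN]; split=> [c X Y | | X].
- rewrite !tensmap_RmapE // mulmxDr mulmxDl -scalemxAr -scalemxAl linN.
  by apply/matrixP => x y; rewrite !mxE mulrDl !mulrA.
- apply: (eq_CP (fun X => esym (tensmap_RmapE linN X))).
  apply: CP_tens_umx; exact: (CP_comp cpN (CP_conj _)).
- by rewrite tensmap_RmapE // trace_tens trace_umx // mulr1 tpN trace_slice0.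
Qed.

(** The factor [t] survives because randomizing into [b] and adjoining [umx m] randomizes into
    [b * m]. *)
Lemma CP_dominated_tens_Rmap {a b} m {N : 'M[C]_a -> 'M[C]_b} {t : C} :
  linmap R N -> CP R (fun X => t *: Rmap R a b X - N X) ->
  CP R (fun X => t *: Rmap R (a * 1) (b * m) X - tensmap R N (Rmap R 1 m) X).
Proof.
move=> linN cpt.
apply: (eq_CP _ (CP_comp (CP_tens_umx m cpt) (CP_conj (slice ord0)))) => X /=;
  rewrite tensmap_RmapE // /Rmap -umx_tens trace_slice0.
by apply/matrixP => x y; rewrite !mxE mulrBl !mulrA.
Qed.

(* The rank-[k] flat state is embedded in the output space as the normalized
   projector P onto the first [k] basis vectors.  The superchannel measures
   {P, 1 - P} and applies M or G := (b R - k M) / (b - k); since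
   k M + (b - k) G = b R, it maps the maximally mixed state to R.  As the
   input of the flat state is trivial, any isometry A' -> R needs |R| >= a,
   so the realization with the isometry V = 1 is minimal. *)
Lemma flat_maj {a b k} {M : 'M[C]_a -> 'M[C]_b} :
  (0 < a)%N -> (0 < k < b)%N -> is_channel R M ->
  CP R (fun X => b%:R *: Rmap R a b X - k%:R *: M X) ->
  maj R (Rmap R 1 k) M.
Proof.
move=> a0 /andP[k0 kb] chM cpG; have [linM cpM tpM] := chM.
have b0 := ltn_trans k0 kb; have [linR _ tpR] := is_channel_Rmap a b0.
have kC : k%:R != 0 :> C by rewrite pnatr_eq0 -lt0n.
have bC : b%:R != 0 :> C by rewrite pnatr_eq0 -lt0n.
have bkC : (b - k)%:R != 0 :> C by rewrite pnatr_eq0 -lt0n subn_gt0.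
pose G X := ((b - k)%:R)^-1 *: (b%:R *: Rmap R a b X - k%:R *: M X).
have chG : is_channel R G.
  split=> [c X Y | | X].
  - rewrite /G linR linM.
    move: (Rmap R a b X) (Rmap R a b Y) (M X) (M Y) => X1 Y1 X2 Y2.
    have swap (d e : C) (Z : 'M[C]_b) : d *: (e *: Z) = e *: (d *: Z).
      by rewrite !scalerA mulrC.
    rewrite -(swap _ c) -scalerDr; congr (_ *: _).
    by rewrite !scalerDr opprD addrACA (swap b%:R) (swap k%:R) scalerN.
  - by apply: CP_scale cpG; rewrite invr_ge0 ler0n.
  - rewrite mxtraceZ raddfB /= (mxtraceZ b%:R) (mxtraceZ k%:R) tpR tpM.
    by rewrite -mulrBl -natrB 1?ltnW // mulrA mulVf // mul1r.
pose Phi (s : 'I_b) := if (s < k)%N then M else G.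
pose E Y := \sum_s Phi s (slice s *m Y *m (slice s) ^t*).
have chE : is_channel R E.
  by apply: is_channel_measure => s; rewrite /Phi; case: ifP.
pose W : 'M[C]_(b, k) := \matrix_(i, j) (val i == val j)%:R.
rewrite /maj ltnNge ltnW //=; exists W; split.
  apply/matrixP => i j; rewrite !mxE (bigD1 (widen_ord (ltnW kb) i)) //=.
  rewrite big1 => [|x /negPf xi].
    by rewrite !mxE /= eqxx conjC_nat mul1r addr0.
  by rewrite !mxE (_ : (val x == val i) = false) ?conjC0 ?mul0r // -xi.
pose V : 'M[C]_(a * 1, a) := (slice ord0) ^t*.
exists (superfun R V E); split.
  exists a, V, E; split.
  - split=> //; exact: isometry_slice_adj.
  - move=> r' W' E' [_ isoW' _ _].
    (* An isometry from dimension [a] into [r' * 1] has at least as many rows as columns. *)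
    by have := mulmx1_min isoW'; rewrite muln1.
  - move=> tau [_ trtau]; rewrite /E.
    (* On the uniform state every outcome has weight 1/b and leaves [tau] in the register. *)
    have slE s : slice s *m (tau *t umx R b) *m (slice s) ^t* = b%:R^-1 *: tau.
      apply/matrixP => i j; rewrite slice_conjE tensmxE !mxE eqxx mulr1.
      by rewrite mulrC.
    under eq_bigr do rewrite slE.
    transitivity (b%:R^-1 *: \sum_(s < b) (if (s < k)%N then M tau else G tau)).
      rewrite scaler_sumr; apply: eq_bigr => s _; rewrite /Phi.
      by case: ifP => _; apply: linmapZ => //; case: chG.
    rewrite sum_if_ltn 1?ltnW // -[M tau *+ k]scaler_nat -[G tau *+ _]scaler_nat.
    rewrite scalerA divff // scale1r addrC subrK scalerA mulVf // scale1r.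
    by rewrite /Rmap trtau scale1r.
move=> X; rewrite /superfun /E.
(* On the embedded flat state the outcomes below [k] have weight 1/k each and the others never
   occur, so [G] is never applied. *)
have slE s : slice s *m ampl R a (isoch R W \o Rmap R 1 k) (isoch R V X)
    *m (slice s) ^t* = (if (s < k)%N then k%:R^-1 else 0) *: X.
  apply/matrixP => i j; rewrite slice_conjE.
  have := blk_ampl (isoch R W \o Rmap R 1 k) (isoch R V X) i j.
  move=> /matrixP/(_ s s); rewrite mxE => ->.
  rewrite /= /isoch /Rmap /umx.
  have -> : \tr (blk R (V *m X *m V ^t*) i j) = X i j.
    rewrite /mxtrace big_ord1 mxE trmxCK.
    have := sum_slice_adj_conj 1 X; rewrite big_ord1 => ->.
    by rewrite tensmxE mxE mulr1.
  rewrite -!scalemxAr mulmx1 -!scalemxAl !mxE mulrC; congr (_ * _).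
  case: ifP => [sk | /negP sk].
    rewrite mulrC (bigD1 (Ordinal sk)) //= big1 => [|x /negPf xs].
      by rewrite !mxE /= eqxx conjC_nat mulr1 addr0 mul1r.
    by rewrite !mxE (_ : (val s == val x) = false) ?mul0r // eq_sym -xs.
  rewrite big1 ?mulr0 // => x _.
  rewrite !mxE (_ : (val s == val x) = false) ?mul0r //.
  by apply/negbTE/eqP => sx; apply: sk; rewrite [nat_of_ord s]sx; apply: ltn_ord.
under [RHS]eq_bigr do rewrite slE.
transitivity (\sum_(s < b) (if (s < k)%N then k%:R^-1 *: M X else 0)).
  rewrite sum_if_ltn 1?ltnW // mul0rn addr0 -[_ *+ k]scaler_nat scalerA.
  by rewrite divff // scale1r.
apply: eq_bigr => s _; rewrite /Phi; case: ifP => _; first by rewrite linmapZ.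
by rewrite scale0r linmap0 //; case: chG.
Qed.

End FlatStates.

(** * The binary logarithm: uniqueness on the naturals, and rational approximation *)

Section Log2.
Context {R : realType}.

Lemma ln2_gt0 : 0 < ln 2 :> R.
Proof. by rewrite ln_gt0 // ltr1n. Qed.

Lemma log2M (x y : R) : 0 < x -> 0 < y -> log2 R (x * y) = log2 R x + log2 R y.
Proof. by move=> x0 y0; rewrite /log2 lnM ?posrE // mulrDl. Qed.

Lemma ler_log2 (x y : R) : 0 < x -> x <= y -> log2 R x <= log2 R y.
Proof.
move=> x0 xy; rewrite /log2 ler_pM2r ?invr_gt0 ?ln2_gt0 // ler_ln ?posrE //.
exact: lt_le_trans xy.
Qed.

Lemma log2_expR (x : R) : log2 R (expR (x * ln 2)) = x.
Proof. by rewrite /log2 expRK mulfK // gt_eqF // ln2_gt0. Qed.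

(** Apply [f] to 2^l <= n^p < 2^(l+1), where additivity gives f(2^l) = l and f(n^p) = p f(n). *)
Lemma additive_nat_bounds (f : nat -> R) :
  (forall m n, (0 < m)%N -> (0 < n)%N -> f (m * n)%N = f m + f n) ->
  (forall m n, (0 < m)%N -> (m <= n)%N -> f m <= f n) -> f 2%N = 1 ->
  forall n p, (0 < n)%N ->
    (trunc_log 2 (n ^ p))%:R <= p%:R * f n <= (trunc_log 2 (n ^ p)).+1%:R.
Proof.
move=> fM f_le f2 n p n0.
have fX m q : (0 < m)%N -> f (m ^ q)%N = q%:R * f m.
  move=> m0; elim: q => [|q IHq].
    (* The value at 1 vanishes, by additivity on a product with 1. *)
    rewrite mul0r; apply: (addrI (f 1%N)).
    by rewrite addr0 -fM.
  by rewrite expnS fM ?expn_gt0 ?m0 // IHq -add1n natrD mulrDl mul1r.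
have np0 : (0 < n ^ p)%N by rewrite expn_gt0 n0.
have /andP[lo /ltnW hi] := trunc_log_bounds (isT : (1 < 2)%N) np0.
have := f_le _ _ _ lo; rewrite !fX // f2 mulr1 expn_gt0 => -> //.
by have := f_le _ _ np0 hi; rewrite !fX // f2 mulr1.
Qed.

Lemma additive_nat_log2 (f : nat -> R) :
  (forall m n, (0 < m)%N -> (0 < n)%N -> f (m * n)%N = f m + f n) ->
  (forall m n, (0 < m)%N -> (m <= n)%N -> f m <= f n) -> f 2%N = 1 ->
  forall n, (0 < n)%N -> f n = log2 R n%:R.
Proof.
move=> fM f_le f2 n n0; pose g n := log2 R n%:R.
have gb p : (trunc_log 2 (n ^ p))%:R <= p%:R * g n <= (trunc_log 2 (n ^ p)).+1%:R.
  apply: additive_nat_bounds => // [k m k0 m0 | k m k0 km |].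
  - by rewrite /g natrM log2M ?ltr0n.
  - by rewrite /g ler_log2 ?ltr0n ?ler_nat.
  - by rewrite /g /log2 divff // gt_eqF // ln2_gt0.
apply/eqP; rewrite -subr_eq0 -normr_eq0; apply: contraT => d0.
have d_gt0 : 0 < `|f n - g n| by rewrite lt0r d0 normr_ge0.
(* Choose p with p |f n - g n| > 1; but p f(n) and p g(n) lie in the same interval of length 1. *)
have := archi_boundP (ltW (etrans (invr_gt0 _) d_gt0)).
set p := Num.bound _; rewrite -(ltr_pM2r d_gt0) mulVf //.
rewrite -[p%:R in X in _ < X -> _](ger0_norm (ler0n R p)) -normrM mulrBr.
have /andP[f_lo f_hi] := additive_nat_bounds f fM f_le f2 n p n0.
have /andP[g_lo g_hi] := gb p; move: f_hi g_hi; rewrite -addn1 natrD => f_hi g_hi.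
rewrite ltNge => /negP[]; rewrite ler_norml -/(g n).
by apply/andP; split; lra.
Qed.

(** A rational between [x] and [y] is positive, so it is a ratio of positive naturals; these will be
    the rank [k] and the dimension [m]. *)
Lemma nat_ratio_between (x y : R) : 0 <= x -> x < y ->
  exists k m, [/\ (0 < k)%N, (0 < m)%N, x * m%:R < k%:R & k%:R < y * m%:R].
Proof.
move=> x0 /rat_in_itvoo[q]; rewrite inE /= => /andP[xq qy].
have q0 : 0 < q by rewrite -(ltr0q R); exact: le_lt_trans xq.
exists `|numq q|%N, `|denq q|%N.
have n0 : 0 < numq q by rewrite numq_gt0.
have d0 := denq_gt0 q.
have ratrE : ratr q = `|numq q|%:R / `|denq q|%:R :> R.
  by rewrite /ratr -{1}(gtr0_norm n0) -{1}(gtr0_norm d0) !natr_absz.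
have dR : 0 < `|denq q|%:R :> R by rewrite ltr0n absz_gt0 denq_neq0.
split; rewrite ?absz_gt0 ?denq_neq0 ?gt_eqF //.
  by rewrite -ltr_pdivlMr // -ratrE.
by rewrite -ltr_pdivrMr // -ratrE.
Qed.

End Log2.

(** * From majorization to the entropy bound *)

Section ChannelEntropy.
Context {R : realType}.
Local Notation C := R[i].

Lemma rC_nat n : rC R n%:R = n%:R.
Proof. exact: (rmorph_nat (real_complex R)). Qed.

Lemma rCB x y : rC R (x - y) = rC R x - rC R y.
Proof. exact: (rmorphB (real_complex R)). Qed.

Lemma rCM x y : rC R (x * y) = rC R x * rC R y.
Proof. exact: (rmorphM (real_complex R)). Qed.

(** The value of [t R - N] at the identity has trace (t - 1) a, which must be nonnegative. *)
Lemma dominating_factor_ge1 {a b} {N : 'M[C]_a -> 'M[C]_b} {t : R} :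
  (0 < a)%N -> (0 < b)%N -> is_channel R N ->
  CP R (fun X => rC R t *: Rmap R a b X - N X) -> 1 <= t.
Proof.
move=> a0 b0 [_ _ tpN] /CP_trace_ge0; have [_ _ tpR] := @is_channel_Rmap R a b b0.
rewrite raddfB /= mxtraceZ tpR tpN mxtrace1 -[X in _ - X]mul1r -mulrBl.
by rewrite pmulr_lge0 ?ltr0n // -[1](rC_nat 1) subr_ge0 /rC lecR.
Qed.

Lemma flat_maj_tens {a b k m} {N : 'M[C]_a -> 'M[C]_b} {t : R} :
  (0 < a)%N -> (0 < b)%N -> (0 < k)%N -> (0 < m)%N -> is_channel R N ->
  CP R (fun X => rC R t *: Rmap R a b X - N X) -> k%:R * t < (b * m)%:R ->
  maj R (Rmap R 1 k) (tensmap R N (Rmap R 1 m)).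
Proof.
move=> a0 b0 k0 m0 chN cpt kt; have [linN _ _] := chN.
have t1 := dominating_factor_ge1 a0 b0 chN cpt.
(* Since t >= 1, k <= k t < b m. *)
have kbm : (k < b * m)%N.
  rewrite -(ltr_nat R); apply: le_lt_trans kt.
  by rewrite ler_peMr // ler0n.
apply: flat_maj.
- by rewrite muln1.
- by rewrite k0.
- exact: is_channel_tens_Rmap.
(* With R' randomizing into [b * m] and N' the tensored channel, b m R' - k N' = k (t R' - N') + (b
   m - k t) R'. *)
have c0 : 0 <= rC R ((b * m)%:R - k%:R * t).
  by rewrite -[0](rC_nat 0) /rC lecR subr_ge0 ltW.
apply: (eq_CP _ (CP_add (CP_scale (ler0n C k) (CP_dominated_tens_Rmap m linN cpt))
  (CP_scale c0 (CP_Rmap _ _)))) => X.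
rewrite rCB rCM !rC_nat scalerBr scalerA scalerBl.
by rewrite [LHS]addrC addrA subrK.
Qed.

Lemma entropy_flat_state (H : forall a b : nat, ('M[C]_a -> 'M[C]_b) -> R) n :
  channel_entropy R H -> (0 < n)%N -> H 1%N n (Rmap R 1 n) = log2 R n%:R.
Proof.
case=> _ H_le HM H2; move: n.
apply: additive_nat_log2 => // [m n m0 n0 | m n m0 mn].
  rewrite -HM //; [|exact: is_channel_Rmap|exact: is_channel_Rmap].
  by rewrite tensmap_Rmap2.
(* Equal ranks are split off because [flat_maj] needs a strictly smaller rank. *)
move: mn; rewrite leq_eqVlt => /predU1P[-> // | mn].
have n0 := ltn_trans m0 mn.
apply: H_le => //; [exact: is_channel_Rmap | exact: is_channel_Rmap |].
apply: flat_maj => //; [by rewrite m0 | exact: is_channel_Rmap |].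
have c0 : (0 : C) <= n%:R - m%:R by rewrite subr_ge0 ler_nat ltnW.
by apply: (eq_CP _ (CP_scale c0 (CP_Rmap 1 n))) => X; rewrite scalerBl.
Qed.

Lemma dominating_factor_lbound
  (H : forall a b : nat, ('M[C]_a -> 'M[C]_b) -> R) {a b}
  {N : 'M[C]_a -> 'M[C]_b} {t : R} :
  channel_entropy R H -> (0 < a)%N -> (0 < b)%N -> is_channel R N ->
  CP R (fun X => rC R t *: Rmap R a b X - N X) ->
  b%:R / expR (H a b N * ln 2) <= t.
Proof.
move=> entH a0 b0 chN cpt; have [_ H_le HM _] := entH.
rewrite leNgt; apply/negP => t_lt.
(* Here x = 2^h, and the assumption t < b / x reads x < b / t. *)
set h := H a b N in t_lt *; set x := expR _ in t_lt.
have x0 : 0 < x by exact: expR_gt0.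
have t_gt0 : 0 < t := lt_le_trans ltr01 (dominating_factor_ge1 a0 b0 chN cpt).
have x_lt : x < b%:R / t.
  by rewrite ltr_pdivlMr // mulrC -ltr_pdivlMr.
have [k [m [k0 m0 xk kt]]] := nat_ratio_between x (b%:R / t) (ltW x0) x_lt.
have a1 : (0 < a * 1)%N by rewrite muln1.
have bm0 : (0 < b * m)%N by rewrite muln_gt0 b0.
have kt' : k%:R * t < (b * m)%:R by rewrite natrM -ltr_pdivlMr // mulrAC.
have := H_le 1%N _ _ _ _ _ isT k0 a1 bm0 (is_channel_Rmap _ k0)
  (is_channel_tens_Rmap m0 chN) (flat_maj_tens a0 b0 k0 m0 chN cpt kt').
rewrite HM // ?(entropy_flat_state H) // -/h; last exact: is_channel_Rmap.
(* Monotonicity and additivity gave log k <= h + log m = log (x m), whereas x m < k. *)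
apply/negP; rewrite -ltNge -(log2_expR h) -/x -log2M ?ltr0n //.
by rewrite /log2 ltr_pM2r ?invr_gt0 ?ln2_gt0 // ltr_ln ?posrE ?mulr_gt0 ?ltr0n.
Qed.

End ChannelEntropy.

Theorem theorem18 (R : realType)
  (H : forall a b : nat, ('M[R[i]]_a -> 'M[R[i]]_b) -> R) :
  channel_entropy R H ->
  forall (a b : nat) (N : 'M[R[i]]_a -> 'M[R[i]]_b),
    (0 < a)%N -> (0 < b)%N -> is_channel R N ->
    Hmin R N <= H a b N.
Proof.
move=> entH a b N a0 b0 chN; rewrite /Hmin lerBlDr.
have x0 : 0 < expR (H a b N * ln 2) by exact: expR_gt0.
(* With x = 2^H, writing b = (b / x) x and cancelling log x reduces the claim to b / x being a lower
   bound of the dominating factors. *)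
rewrite -[X in _ <= X + _]log2_expR addrC.
rewrite -[X in log2 R X <= _](divfK (lt0r_neq0 x0)) log2M ?divr_gt0 ?ltr0n //.
rewrite lerD2r ler_log2 ?divr_gt0 ?ltr0n //; apply: lb_le_inf.
  by exists (b ^ 2)%:R; split; [exact: ler0n | exact: CP_dominated_by_Rmap].
by move=> t [_ cpt]; exact: dominating_factor_lbound.
Qed.
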